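(* Let $p\neq2$ be a prime, let $F$ be a finite field extension of $\mathbb{Q}_p$ and let $E=F(\alpha)$ be a quadratic extension of $F$, with $\alpha^2\in F^*$ and $\alpha\notin F$. Then any Chabauty limit of $\mathrm{SL}(2,F)$ inside $\mathrm{SL}(2,E)$ is $\mathrm{SL}(2,E)$-conjugate to either $\mathrm{SL}(2,F)$, or to the subgroup $$\left\{\begin{pmatrix} a-\alpha b& z\\ 0& a+\alpha b\end{pmatrix}\ \middle|\ a,b\in F\text{ with }a^2-\alpha^2b^2=1,\ z\in E\right\}\leq B_E^{+}.$$
   Context: For a locally compact group $G$, the set $\mathcal{S}(G)$ of closed subgroups carries the Chabauty topology; for $G$ metrizable, $H_n\to H$ in $\mathcal{S}(G)$ iff (1) every $h\in H$ is the limit of some sequence $h_n\in H_n$, and (2) whenever $h_n\in H_n$ and a subsequence $h_{n_k}$ converges to some $h\in G$, then $h\in H$. A Chabauty limit of a closed subgroup $H\le G$ inside $G$ is a closed subgroup that is a limit in $\mathcal{S}(G)$ of a sequence of conjugates $g_nHg_n^{-1}$, $g_n\in G$. $B_E^{+}$ is the group of upper triangular matrices in $\mathrm{SL}(2,E)$. *)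

(* Defs.v *)
From HB Require Import structures.
From mathcomp Require Import all_boot all_order all_algebra all_field.
From mathcomp Require Import all_classical all_reals all_analysis.

Set Implicit Arguments.
Unset Strict Implicit.
Unset Printing Implicit Defensive.

Import Order.TTheory GRing.Theory Num.Theory.
Import numFieldNormedType.Exports.
Local Open Scope classical_set_scope.
Local Open Scope ring_scope.

Section AbsoluteValues.
Variable R : realType.

Record nonarch_abs (K : fieldType) (v : K -> R) : Prop := NonarchAbs {
  nonarch_abs_ge0 : forall x, 0 <= v x;
  nonarch_abs_eq0 : forall x, v x = 0 <-> x = 0;
  nonarch_absM : forall x y, v (x * y) = v x * v y;
  nonarch_absD : forall x y, v (x + y) <= Num.max (v x) (v y)
}.

Definition abs_cvg (K : fieldType) (v : K -> R) (u : nat -> K) (l : K) : Prop :=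
  (fun n => v (u n - l)) @ \oo --> (0 : R).

Definition abs_cauchy (K : fieldType) (v : K -> R) (u : nat -> K) : Prop :=
  forall e : R, 0 < e ->
    exists N : nat, forall m n, (N <= m)%N -> (N <= n)%N -> v (u m - u n) < e.

Definition padic_abs (p : nat) (q : rat) : R :=
  if q == 0 then 0
  else p%:R ^ ((logn p `|denq q|%N)%:Z - (logn p `|numq q|%N)%:Z).

(* (K, v) is a completion of rat for the p-adic absolute value; this determines
   the valued field Q_p up to a unique isometric isomorphism. *)
Record padic_field (p : nat) (K : fieldType) (v : K -> R) : Prop := PadicField {
  padic_field_abs : nonarch_abs v;
  padic_field_rat : forall q : rat, v (ratr q) = padic_abs p q;
  padic_field_dense :
    forall (x : K) (e : R), 0 < e -> exists q : rat, v (x - ratr q) < e;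
  padic_field_complete :
    forall u : nat -> K, abs_cauchy v u -> exists l, abs_cvg v u l
}.

End AbsoluteValues.

(* Subgroups of GL_n(K) are represented as sets of matrices; the topology is the
   entrywise one induced by v, which is metrizable, so that closedness and
   Chabauty convergence are expressed with sequences. *)
Section Chabauty.
Variables (R : realType) (K : fieldType) (v : K -> R) (n : nat).
Implicit Types (G H L : set 'M[K]_n).

Definition mx_cvg (u : nat -> 'M[K]_n) (A : 'M[K]_n) : Prop :=
  forall i j, abs_cvg v (fun m => u m i j) (A i j).

Definition conj_set (g : 'M[K]_n) H : set 'M[K]_n :=
  [set g *m A *m invmx g | A in H].

Definition conjugate_in G H L : Prop := exists2 g, G g & H = conj_set g L.

Record closed_subgroup G H : Prop := ClosedSubgroup {
  closed_subgroup_sub : H `<=` G;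
  closed_subgroup1 : H 1%:M;
  closed_subgroupM : forall A B, H A -> H B -> H (A *m B);
  closed_subgroupV : forall A, H A -> H (invmx A);
  closed_subgroup_closed : forall (u : nat -> 'M[K]_n) A,
    (forall m, H (u m)) -> G A -> mx_cvg u A -> H A
}.

Definition chabauty_cvg G (Hs : nat -> set 'M[K]_n) H : Prop :=
  (forall A, H A ->
     exists2 u : nat -> 'M[K]_n, (forall m, Hs m (u m)) & mx_cvg u A) /\
  (forall (u : nat -> 'M[K]_n) (k : nat -> nat) A,
     (forall m, Hs m (u m)) -> {homo k : i j / (i < j)%N} -> G A ->
     mx_cvg (u \o k) A -> H A).

Definition chabauty_limit G H L : Prop :=
  closed_subgroup G L /\
  exists2 g : nat -> 'M[K]_n, (forall m, G (g m)) &
    chabauty_cvg G (fun m => conj_set (g m) H) L.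

End Chabauty.

Definition SL (n : nat) (K : fieldType) : set 'M[K]_n := [set A | \det A = 1].
Arguments SL n K : clear implicits.

Definition SL_sub (n : nat) (F : fieldType) (E : fieldExtType F) :
    set 'M[E]_n :=
  [set map_mx (in_alg E) B | B in SL n F].
Arguments SL_sub n {F} E.

Definition mx2 (K : fieldType) (a b c d : K) : 'M[K]_2 :=
  \matrix_(i, j) (if i == 0 then if j == 0 then a else b
                  else if j == 0 then c else d).

Definition nonsplit_borel (F : fieldType) (E : fieldExtType F) (alpha : E) :
    set 'M[E]_2 :=
  [set A | exists a b : F, exists z : E,
     a%:A ^+ 2 - alpha ^+ 2 * b%:A ^+ 2 = 1 /\
     A = mx2 (a%:A - alpha * b%:A) z 0 (a%:A + alpha * b%:A)].

(* Main.v *)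
Require Import Defs.
From HB Require Import structures.
From mathcomp Require Import all_boot all_order all_algebra all_field.
From mathcomp Require Import all_classical all_reals all_analysis.
From mathcomp Require Import ring.

Set Implicit Arguments.
Unset Strict Implicit.
Unset Printing Implicit Defensive.

Import Order.TTheory GRing.Theory Num.Theory.
Import numFieldNormedType.Exports.
Local Open Scope classical_set_scope.
Local Open Scope ring_scope.

(** Let [s] be the conjugation of [E] over [F] and [adj A] the conjugate
    transpose of [A]. Every matrix [A] of determinant 1 preserves the symplectic
    matrix J in the sense that [A *m J *m A^T = J]; so [A] has entries in [F] if and
    only if it preserves the hermitian form [herm0 = alpha J]. Thus SL(2, F) is the
    special unitary group of [herm0] ([SU_herm0]), and its conjugate by [g] is that of
    the hermitian form [g *m herm0 *m adj g], which again has determinant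
    [alpha ^+ 2]. The theorem is a statement on limits of such forms.

    If the upper left entry [x] of such a form is nonzero, completing the square
    by a unipotent matrix [u] turns it into [diag (x, alpha ^+ 2 / x)]
    ([herm_diag]), whose special unitary group depends on [r = 1 / x] only:
    it is the group [SUdiag r] of the matrices with first row [(a, b)] and second
    row [(- (alpha r)^2 s(b), s(a))], where [a s(a) + (alpha r)^2 b s(b) = 1]. This
    group also makes sense for [r = 0], where it is the subgroup of the Borel group
    in the theorem ([SUdiag0_borel]); for [r <> 0] it is conjugate to SL(2, F)
    ([SUdiag_conj]).

    Given conjugating matrices [g n], one of four fixed frames [w] makes the upper
    left entry comparable to the largest entry of the form ([good_frame]); then
    [r n = 1 / x] and the unipotent matrix [u n] remain bounded, whether or
    not the forms themselves diverge. Their limits [r] and [u] exist by local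
    compactness of [E], and the conjugates of SL(2, F) converge to the conjugate of
    [SUdiag r] by the limit of the frames ([unitary_limit]). One inclusion is
    continuity ([SUdiag_closed]); for the other, each element of [SUdiag r] is a limit
    of elements of the groups [SUdiag (r n)] ([SUdiag_approx]), because the quadric
    that defines them has a rational parametrization.

    Limits are taken along one free ultrafilter on the indices, which determines
    the Chabauty limit ([chabauty_ultra]) and along which bounded sequences
    converge: in the p-adic numbers by total boundedness and completeness
    ([padic_ucompact]), and in their finite extensions by adjoining one vector
    at a time ([ucompact_add]). *)

(** * Ultrametric absolute values *)

Section AbsTheory.
Variables (R : realType) (K : fieldType) (v : K -> R).
Hypothesis vP : nonarch_abs v.

Lemma abs_ge0 x : 0 <= v x. Proof. by case: vP => + _ _ _; apply. Qed.

Lemma absM x y : v (x * y) = v x * v y. Proof. by case: vP. Qed.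

Lemma abs0 : v 0 = 0. Proof. by case: vP => _ /(_ 0)[_ ->]. Qed.

Lemma abs_gt0 x : x != 0 -> 0 < v x.
Proof.
move=> x0; rewrite lt_def abs_ge0 andbT; apply: contra_neq x0.
by case: vP => _ /(_ x)[].
Qed.

Lemma abs1 : v 1 = 1.
Proof.
have v10 : v 1 != 0 by rewrite gt_eqF ?abs_gt0 ?oner_neq0.
by apply: (mulfI v10); rewrite -absM !mulr1.
Qed.

Lemma absN x : v (- x) = v x.
Proof.
suff vN1 : v (-1) = 1 by rewrite -mulN1r absM vN1 mul1r.
have /eqP : v (-1) ^+ 2 = 1 by rewrite expr2 -absM mulrNN mulr1 abs1.
rewrite sqrf_eq1 => /orP[/eqP//|/eqP vE].
by have := abs_ge0 (-1); rewrite vE lerNr oppr0 ler10.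
Qed.

Lemma absV x : v x^-1 = (v x)^-1.
Proof.
have [->|x0] := eqVneq x 0; first by rewrite invr0 abs0 invr0.
have vx0 : v x != 0 by rewrite gt_eqF ?abs_gt0.
by apply: (mulfI vx0); rewrite -absM !divff ?abs1.
Qed.

Lemma absX x n : v (x ^+ n) = v x ^+ n.
Proof. by elim: n => [|n IH]; rewrite ?abs1 // !exprS absM IH. Qed.

Lemma absD_le x y C : v x <= C -> v y <= C -> v (x + y) <= C.
Proof.
by move=> xC yC; case: vP => _ _ _ /(_ x y)/le_trans; apply; rewrite ge_max xC.
Qed.

Lemma absB_le x y C : v x <= C -> v y <= C -> v (x - y) <= C.
Proof. by move=> xC yC; apply: absD_le; rewrite ?absN. Qed.

Lemma absD_lt x y C : v x < C -> v y < C -> v (x + y) < C.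
Proof.
by move=> xC yC; case: vP => _ _ _ /(_ x y)/le_lt_trans; apply; rewrite gt_max xC.
Qed.

Lemma absB_lt x y C : v x < C -> v y < C -> v (x - y) < C.
Proof. by move=> xC yC; apply: absD_lt; rewrite ?absN. Qed.

Lemma abs_natr n : v n%:R <= 1.
Proof.
elim: n => [|n IH]; first by rewrite abs0.
by rewrite -natr1; apply: absD_le => //; rewrite abs1.
Qed.

Lemma abs_intr (m : int) : v m%:~R <= 1.
Proof. by case: m => n; rewrite ?NegzE ?mulrNz ?absN; apply: abs_natr. Qed.

End AbsTheory.

(** * Limits along a filter on the indices *)

Section FilterLimits.
Variables (R : realType) (K : fieldType) (v : K -> R).
Hypothesis vP : nonarch_abs v.
Variables (U : set_system nat).
Context {UF : ProperFilter U}.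
Implicit Types (f g : nat -> K) (a b : K).

(** Limits are taken along an arbitrary filter [U], to be instantiated with a
    free ultrafilter: every bounded sequence then converges, so that no
    subsequence ever has to be extracted or relabelled. *)
Definition tends f a : Prop :=
  forall e : R, 0 < e -> \forall n \near U, v (f n - a) < e.

Definition ubounded f : Prop := exists C : R, \forall n \near U, v (f n) <= C.

Lemma tends_near f g a : (\forall n \near U, f n = g n) -> tends f a -> tends g a.
Proof.
move=> fg fa e e0; near=> n.
by have <- : f n = g n; [near: n | near: n; apply: fa].
Unshelve. all: by end_near. Qed.

Lemma tends_cst a : tends (fun=> a) a.
Proof. by move=> e e0; near=> n; rewrite subrr (abs0 vP).
Unshelve. all: by end_near. Qed.

Lemma tendsD f g a b : tends f a -> tends g b -> tends (fun n => f n + g n) (a + b).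
Proof.
move=> fa gb e e0; near=> n; rewrite opprD addrACA.
by apply: (absD_lt vP); near: n; [apply: fa|apply: gb].
Unshelve. all: by end_near. Qed.

Lemma tendsN f a : tends f a -> tends (fun n => - f n) (- a).
Proof.
move=> fa e e0; near=> n; rewrite -opprD (absN vP).
by near: n; apply: fa.
Unshelve. all: by end_near. Qed.

Lemma tendsB f g a b : tends f a -> tends g b -> tends (fun n => f n - g n) (a - b).
Proof. by move=> fa gb; apply: tendsD => //; apply: tendsN. Qed.

Lemma tends_ubounded f a : tends f a -> ubounded f.
Proof.
move=> fa; exists (Num.max 1 (v a)); near=> n.
rewrite -(subrK a (f n)); apply: (absD_le vP); rewrite le_max ?lexx ?orbT //.
by rewrite ltW //; near: n; apply: fa.
Unshelve. all: by end_near. Qed.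

Lemma uboundedP f :
  ubounded f <-> exists2 C, 0 < C & \forall n \near U, v (f n) <= C.
Proof.
split=> [[C fC]|[C _ fC]]; last by exists C.
exists (Num.max 1 C); first by rewrite lt_max ltr01.
near=> n; rewrite le_max; apply/orP; right; near: n; exact: fC.
Unshelve. all: by end_near. Qed.

Lemma ubounded_cst a : ubounded (fun=> a).
Proof. by exists (v a); near=> n.
Unshelve. all: by end_near. Qed.

Lemma uboundedM f g : ubounded f -> ubounded g -> ubounded (fun n => f n * g n).
Proof.
move=> [C fC] [D gD]; exists (C * D); near=> n.
by rewrite (absM vP) ler_pM ?(abs_ge0 vP) //; near: n.
Unshelve. all: by end_near. Qed.

Lemma uboundedD f g : ubounded f -> ubounded g -> ubounded (fun n => f n + g n).
Proof.
move=> [C fC] [D gD]; exists (Num.max C D); near=> n.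
by apply: (absD_le vP); rewrite le_max; apply/orP; [left|right]; near: n.
Unshelve. all: by end_near. Qed.

Lemma uboundedB f g : ubounded f -> ubounded g -> ubounded (fun n => f n - g n).
Proof.
move=> fC [D gD]; apply: uboundedD => //; exists D.
by near=> n; rewrite (absN vP); near: n.
Unshelve. all: by end_near. Qed.

Lemma ubounded_sqrt f : ubounded (fun n => f n * f n) -> ubounded f.
Proof.
move=> /uboundedP[C C0 fC]; exists (Num.max 1 C); near=> n.
have : v (f n * f n) <= C by near: n.
rewrite (absM vP) le_max; have [//|v1] := leP (v (f n)) 1.
by apply: le_trans; rewrite ler_peMl ?(abs_ge0 vP) ?ltW.
Unshelve. all: by end_near. Qed.

Lemma tends0M f g : tends f 0 -> ubounded g -> tends (fun n => f n * g n) 0.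
Proof.
move=> f0 /uboundedP[C C0 gC] e e0; near=> n.
rewrite subr0 (absM vP) -(divfK (lt0r_neq0 C0) e).
apply: (@le_lt_trans _ _ (v (f n) * C)).
  by rewrite ler_wpM2l ?(abs_ge0 vP) //; near: n.
rewrite ltr_pM2r // -[f n]subr0; near: n; apply: f0; exact: divr_gt0.
Unshelve. all: by end_near. Qed.

Lemma tends_sub0 f a : tends f a -> tends (fun n => f n - a) 0.
Proof. by move=> fa e /fa; apply: filterS => n; rewrite subr0. Qed.

Lemma tends_of_sub0 f a : tends (fun n => f n - a) 0 -> tends f a.
Proof. by move=> fa e /fa; apply: filterS => n; rewrite subr0. Qed.

Lemma tendsM f g a b : tends f a -> tends g b -> tends (fun n => f n * g n) (a * b).
Proof.
move=> fa gb; apply: tends_of_sub0.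
have -> : (fun n => f n * g n - a * b) =
    (fun n => (f n - a) * g n + (g n - b) * a) by apply: funext => n; ring.
rewrite -(addr0 0); apply: tendsD; apply: tends0M.
- exact: tends_sub0.
- exact: tends_ubounded gb.
- exact: tends_sub0.
- exact: ubounded_cst.
Qed.

Lemma tends_unique f a b : tends f a -> tends f b -> a = b.
Proof.
move=> fa fb; apply/eqP; rewrite -subr_eq0; apply/negPn/negP => ab0.
have e0 := abs_gt0 vP ab0.
have [n [na nb]] := filter_ex (filterI (fa _ e0) (fb _ e0)).
have := absB_lt vP nb na.
by rewrite opprB addrC subrKA ltxx.
Qed.

(** The ultrametric inequality makes [v] locally constant away from 0. *)
Lemma tends_neq0 f a : a != 0 -> tends f a -> \forall n \near U, v (f n) = v a.
Proof.
move=> a0 fa; near=> n.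
have lt1 : v (f n - a) < v a by near: n; apply: fa; apply: abs_gt0.
apply/eqP; rewrite eq_le; apply/andP; split.
  by rewrite -(subrK a (f n)); apply: (absD_le vP); rewrite ?lexx // ltW.
rewrite leNgt; apply/negP => lt2.
by have := absB_lt vP lt2 lt1; rewrite subKr ltxx.
Unshelve. all: by end_near. Qed.

Lemma tendsV f a : a != 0 -> tends f a -> tends (fun n => (f n)^-1) a^-1.
Proof.
move=> a0 fa; apply: tends_of_sub0.
have vfa := tends_neq0 a0 fa.
apply: (@tends_near (fun n => (f n - a) * - ((f n)^-1 * a^-1))).
  near=> n; have f0 : f n != 0.
    apply/eqP => fn0; have : v (f n) = v a by near: n.
    by rewrite fn0 (abs0 vP) => /esym/eqP; rewrite gt_eqF ?(abs_gt0 vP).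
  by field; rewrite f0 a0.
apply: tends0M; first exact: tends_sub0.
exists (v a^-1 * v a^-1); near=> n.
rewrite (absN vP) (absM vP) (absV vP).
have -> : v (f n) = v a by near: n.
by rewrite (absV vP).
Unshelve. all: by end_near. Qed.

End FilterLimits.

(** * Compactness of bounded sets along an ultrafilter *)

Section Compactness.
Variables (R : realType) (K : fieldType) (v : K -> R).
Hypothesis vP : nonarch_abs v.
Variables (U : set_system nat).
Context {UU : UltraFilter U}.
Hypothesis U_oo : \oo `<=` U.
Implicit Types (V k : set K) (f : nat -> K).

(** Compactness of the bounded closed subsets of [V], tested on the single
    ultrafilter [U]. *)
Definition ucompact V : Prop :=
  forall f, (forall n, V (f n)) -> ubounded v U f -> exists2 l, V l & tends v U f l.

Lemma ultra_or (P Q : set nat) : U (P `|` Q) -> U P \/ U Q.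
Proof.
move=> UPQ; have [|UnP] := in_ultra_setVsetC P UU; [by left | right].
by apply: filterS (filterI UPQ UnP) => n [[]].
Qed.

Lemma ultra_exists_seq (T : eqType) (s : seq T) (P : T -> set nat) :
  (\forall n \near U, exists2 t, t \in s & P t n) ->
  exists2 t, t \in s & U (P t).
Proof.
elim: s => [|t s IH] sP.
  by have [n [t]] := filter_ex sP.
have [Ut|Us] : U (P t) \/ \forall n \near U, exists2 t, t \in s & P t n.
- apply: ultra_or; apply: filterS sP => n [t' + Pt'].
  by rewrite inE => /predU1P[<-|ts]; [left | right; exists t'].
- by exists t; rewrite ?mem_head.
by have [t' ts Pt'] := IH Us; exists t'; rewrite // inE ts orbT.
Qed.

Lemma natSinv_lt (e : R) : 0 < e -> \forall n \near U, n.+1%:R^-1 < e.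
Proof. by move=> e0; apply: U_oo; apply: (near_infty_natSinv_lt (PosNum e0)). Qed.

(** A sequence of [V] approaching [e] would be bounded, hence would have its
    limit [e] in [V]. *)
Lemma ucompact_dist V e : ucompact V -> ~ V e ->
  exists2 d, 0 < d & forall x, V x -> d <= v (x - e).
Proof.
move=> Vc Ve; apply: contrapT => far.
have /choice[f fV] : forall n : nat, exists x, V x /\ v (x - e) < n.+1%:R^-1.
  move=> n; apply: contrapT => nx; apply: far; exists n.+1%:R^-1.
    by rewrite invr_gt0 ltr0Sn.
  by move=> x Vx; rewrite leNgt; apply/negP => xe; apply: nx; exists x.
have fe : tends v U f e.
  move=> d d0; near=> n; apply: lt_trans (fV n).2 _; near: n; exact: natSinv_lt.
have [l Vl fl] := Vc f (fun n => (fV n).1) (tends_ubounded vP fe).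
by apply: Ve; rewrite (tends_unique vP fe fl).
Unshelve. all: by end_near. Qed.

(** Scaling [x + c * e] by the inverse of [- c] turns the positive distance from
    [e] to [V] into a bound on the coefficient [c]. *)
Lemma ucompact_coeff k V e : k (-1) -> (forall c, k c -> k c^-1) ->
  (forall c x, k c -> V x -> V (c * x)) -> ucompact V -> ~ V e ->
  exists2 d, 0 < d & forall x c, V x -> k c -> v c * d <= v (x + c * e).
Proof.
move=> kN1 kV kVV Vc Ve; have [d d0 dP] := ucompact_dist Vc Ve.
exists d => // x c Vx kc; have [->|c0] := eqVneq c 0.
  by rewrite (abs0 vP) mul0r (abs_ge0 vP).
have -> : x + c * e = - c * (-1 * (c^-1 * x) - e) by field.
rewrite (absM vP) (absN vP) ler_wpM2l ?(abs_ge0 vP) // dP //.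
by apply: (kVV _ _ kN1); apply: kVV => //; apply: kV.
Qed.

(** The induction step for finite extensions. A bounded sequence [y + c * e] has
    bounded coefficients [c], hence bounded [y], and both converge. This yields
    completeness and the equivalence of norms in one stroke. *)
Lemma ucompact_add k V e : k (-1) -> (forall c, k c -> k c^-1) ->
  (forall c x, k c -> V x -> V (c * x)) ->
  ucompact k -> ucompact V -> ~ V e ->
  ucompact [set x | exists2 y, V y & exists2 c, k c & x = y + c * e].
Proof.
move=> kN1 kV kVV kc Vc Ve f fV fb.
have [d d0 dP] := ucompact_coeff kN1 kV kVV Vc Ve.
have /choice[y yP] : forall n, exists yc : K * K,
    [/\ V yc.1, k yc.2 & f n = yc.1 + yc.2 * e].
  by move=> n; have [y Vy [c kc' ->]] := fV n; exists (y, c).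
have cb : ubounded v U (fun n => (y n).2).
  have [C fC] := fb; exists (C / d); near=> n.
  have [Vy ky fE] := yP n; rewrite ler_pdivlMr //.
  by apply: le_trans (dP _ _ Vy ky) _; rewrite -fE; near: n.
have [c kc' cl] := kc _ (fun n => let: And3 _ h _ := yP n in h) cb.
have yE : (fun n => (y n).1) = (fun n => f n - (y n).2 * e).
  by apply: funext => n; have [_ _ ->] := yP n; rewrite addrK.
have yb : ubounded v U (fun n => (y n).1).
  rewrite yE; apply: (uboundedB vP) => //.
  by apply: (uboundedM vP) => //; apply: ubounded_cst.
have [z Vz yz] := Vc _ (fun n => let: And3 h _ _ := yP n in h) yb.
exists (z + c * e); first by exists z => //; exists c.
have -> : f = (fun n => (y n).1 + (y n).2 * e).
  by apply: funext => n; have [] := yP n.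
apply: (tendsD vP) => //; apply: (tendsM vP) => //; exact: tends_cst.
Unshelve. all: by end_near. Qed.

End Compactness.

(** * Bounded sequences of p-adic numbers *)

Section Padic.
Variables (R : realType) (p : nat) (K : fieldType) (v : K -> R).
Hypotheses (p_prime : prime p) (KP : padic_field p v).
Let vP := padic_field_abs KP.

Lemma padic_abs_nat n : n != 0%N -> v n%:R = p%:R ^- logn p n.
Proof.
move=> n0; have -> : n%:R = ratr n%:Q :> K by rewrite ratr_int.
rewrite (padic_field_rat KP) /padic_abs intr_eq0 eqz_nat (negPf n0).
by rewrite numq_int denq_int /= logn1 sub0r exprnN.
Qed.

Lemma padic_abs_p : v p%:R = p%:R^-1.
Proof.
have p0 := prime_gt0 p_prime.
by rewrite padic_abs_nat -?lt0n // lognE p_prime p0 dvdnn divnn p0 logn1 expr1.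
Qed.

Lemma padic_char0 n : n != 0%N -> n%:R != 0 :> K.
Proof.
move=> n0; apply/eqP => nE; have := padic_abs_nat n0.
rewrite nE (abs0 vP) => /esym/eqP; rewrite invr_eq0 expf_eq0 pnatr_eq0.
by case: p p_prime => // ? _; rewrite andbF.
Qed.

Lemma padic_abs_unit n : coprime p n -> v n%:R = 1.
Proof.
move=> pn; have n0 : n != 0%N.
  by apply: contraTneq pn => ->; rewrite /coprime gcdn0 neq_ltn prime_gt1 // orbT.
move: pn; rewrite prime_coprime // => /negPf pn.
by rewrite padic_abs_nat // lognE pn !andbF expr0 invr1.
Qed.

Lemma padic_abs_p_lt1 : v p%:R < 1.
Proof. by rewrite padic_abs_p invf_lt1 ?ltr1n ?ltr0n ?prime_gt1 ?prime_gt0. Qed.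

Lemma padic_abs_p_gt0 : 0 < v p%:R.
Proof. by rewrite padic_abs_p invr_gt0 ltr0n prime_gt0. Qed.

Lemma padic_abs_intr_unit (m : int) : coprime p `|m| -> v m%:~R = 1.
Proof. by case: m => n /=; rewrite ?NegzE ?mulrNz ?(absN vP); apply: padic_abs_unit. Qed.

(** Density replaces [z] by a rational number of absolute value at most 1; its
    denominator is prime to [p], so the Chinese remainder theorem turns it into a
    residue modulo [p ^ m]. *)
Lemma padic_residue (z : K) (m : nat) : v z <= 1 ->
  exists2 c : nat, (c < p ^ m)%N & v (z - c%:R) <= v p%:R ^+ m.
Proof.
move=> z1; have pm0 := exprn_gt0 m padic_abs_p_gt0.
have [q zq] := padic_field_dense KP z pm0.
have q1 : v (ratr q) <= 1.
  rewrite -(subKr z (ratr q)); apply: (absB_le vP) => //.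
  rewrite ltW //; apply: lt_le_trans zq _.
  by rewrite exprn_ile1 ?(abs_ge0 vP) // ltW ?padic_abs_p_lt1.
have den0 : ((denq q)%:~R : K) != 0.
  rewrite -absz_denq; apply: padic_char0; by rewrite absz_eq0 denq_eq0.
have cop : coprime p `|denq q|.
  rewrite prime_coprime //; apply/negP => pden.
  have num1 : v (numq q)%:~R = 1.
    apply: padic_abs_intr_unit; rewrite prime_coprime //; apply/negP => pnum.
    have := coprime_num_den q; rewrite /coprime => /eqP g1.
    have : (p %| gcdn `|numq q| `|denq q|)%N by rewrite dvdn_gcd pnum.
    by rewrite g1 dvdn1 => /eqP p1; move: p_prime; rewrite p1.
  have denlt : v (denq q)%:~R < 1.
    rewrite -absz_denq; have /dvdnP[k ->] := pden; rewrite -pmulrn natrM (absM vP).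
    apply: le_lt_trans padic_abs_p_lt1.
    by rewrite ler_piMl ?(abs_ge0 vP) ?(abs_natr vP).
  move: q1; rewrite /ratr (absM vP) (absV vP) num1 mul1r invf_le1 ?leNgt ?denlt //.
  exact: (abs_gt0 vP).
have [c cp cP] : exists2 c : nat, (c < p ^ m)%N &
    exists k : int, numq q = denq q * c%:Z + (p ^ m)%N%:Z * k.
  have P0 : (p ^ m)%N%:Z != 0 by rewrite eqz_nat expn_eq0 -leqn0 leqNgt prime_gt0.
  have copz : coprimez (p ^ m)%N (denq q) by rewrite coprimezE /= coprimeXl.
  (* X is divisible by the denominator and congruent to the numerator; the
     quotient, reduced modulo p ^ m, is the residue. *)
  pose X := zchinese (p ^ m)%N (denq q) (numq q) 0.
  have /dvdzP[c0 XE] : (denq q %| X)%Z.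
    by apply/dvdz_mod0P; rewrite zchinese_modr // mod0z.
  exists `|(c0 %% (p ^ m)%N)%Z|%N.
    by rewrite -ltz_nat gez0_abs ?modz_ge0 // ltz_pmod // ltz_nat expn_gt0 prime_gt0.
  have /dvdzP[k kE] : ((p ^ m)%N %| numq q - denq q * (c0 %% (p ^ m)%N)%Z)%Z.
    rewrite -eqz_mod_dvd -modzMmr modz_mod modzMmr mulrC -XE; apply/eqP.
    by rewrite zchinese_modl.
  by exists k; rewrite gez0_abs ?modz_ge0 // [RHS]addrC mulrC -kE subrK.
exists c => //; rewrite -(subrKA (ratr q)).
apply: (absD_le vP); first exact: ltW.
have [k qE] := cP; have -> : ratr q - c%:R = (p%:R ^+ m) * k%:~R / (denq q)%:~R :> K.
  by rewrite /ratr {1}qE rmorphD !rmorphM /= -!pmulrn natrX; field.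
rewrite !(absM vP) (absX vP) (absV vP) (padic_abs_intr_unit cop) invr1 mulr1.
by rewrite ler_piMr ?(abs_intr vP) // ltW.
Qed.

Lemma padic_tot_bounded (C e : R) : 0 < e ->
  exists s : seq K, forall x, v x <= C -> exists2 y, y \in s & v (x - y) < e.
Proof.
move=> e0.
have small (d : R) : 0 < d -> exists m, v p%:R ^+ m < d.
  move=> d0; have /cvgrPdist_lt/(_ d d0)[m _ /(_ m (leqnn m))] : GRing.exp (v p%:R) @ \oo --> 0.
    by apply: cvg_expr; rewrite ger0_norm ?(abs_ge0 vP) ?padic_abs_p_lt1.
  by rewrite /= sub0r normrN ger0_norm ?exprn_ge0 ?(abs_ge0 vP) // => ?; exists m.
have [j jC] : exists j, v p%:R ^+ j < (Num.max 1 C)^-1.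
  by apply: small; rewrite invr_gt0 lt_max ltr01.
have pj0 := exprn_gt0 j padic_abs_p_gt0.
have [m me] : exists m, v p%:R ^+ m < e * v p%:R ^+ j.
  by apply: small; rewrite mulr_gt0.
have p0 : p%:R ^+ j != 0 :> K.
  by rewrite expf_eq0 (negPf (padic_char0 _)) ?andbF // -lt0n prime_gt0.
exists [seq c%:R / p%:R ^+ j | c <- iota 0 (p ^ m)] => x xC.
have [|c cm xc] := @padic_residue (x * p%:R ^+ j) m.
  rewrite (absM vP) (absX vP) -ler_pdivlMr // mul1r.
  have M0 : 0 < Num.max 1 C by rewrite lt_max ltr01.
  apply: (le_trans xC); apply: (@le_trans _ _ (Num.max 1 C)).
    by rewrite le_max lexx orbT.
  by rewrite -[Num.max 1 C]invrK lef_pV2 ?posrE ?invr_gt0 // ltW.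
exists (c%:R / p%:R ^+ j).
  by apply/mapP; exists c; rewrite // mem_iota add0n.
have -> : x - c%:R / p%:R ^+ j = (x * p%:R ^+ j - c%:R) / p%:R ^+ j by field.
rewrite (absM vP) (absV vP) (absX vP) ltr_pdivrMr //.
exact: le_lt_trans xc me.
Qed.



(** For each [m] the ultrafilter selects one of the finitely many balls of
    radius [1 / (m + 1)]; the centres of the selected balls form a Cauchy sequence
    because two members of [U] always meet. *)
Lemma padic_ucompact (U : set_system nat) (UU : UltraFilter U) (U_oo : \oo `<=` U) :
  ucompact v U setT.
Proof.
move=> f _ [C fC].
have /choice[y yP] : forall m : nat, exists y, \forall n \near U, v (f n - y) < m.+1%:R^-1.
  move=> m; have [|s sP] := @padic_tot_bounded C m.+1%:R^-1.
    by rewrite invr_gt0 ltr0Sn.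
  have [|y _ yP] := @ultra_exists_seq U UU _ s (fun y n => v (f n - y) < m.+1%:R^-1).
    by apply: filterS fC => n; apply: sP.
  by exists y.
have [l yl] : exists l, abs_cvg v y l.
  apply: (padic_field_complete KP) => e e0.
  have [N _ Ne] := near_infty_natSinv_lt (PosNum e0).
  exists N => m n Nm Nn.
  have [k [km kn]] := filter_ex (filterI (yP m) (yP n)).
  have -> : y m - y n = (f k - y n) - (f k - y m) by ring.
  by apply: (absB_lt vP); [apply: lt_trans kn _|apply: lt_trans km _]; apply: Ne.
exists l => // e e0; near \oo => m.
have me : m.+1%:R^-1 < e.
  by near: m; apply: (near_infty_natSinv_lt (PosNum e0)).
have yle : v (y m - l) < e.
  near: m; move/cvgrPdist_lt: yl => /(_ e e0); apply: filterS => n.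
  by rewrite sub0r normrN ger0_norm ?(abs_ge0 vP).
apply: filterS (yP m) => n fy; rewrite -(subrKA (y m)).
by apply: (absD_lt vP) => //; apply: lt_trans fy me.
Unshelve. all: by end_near. Qed.

End Padic.

(** * The conjugation of a quadratic extension *)

Section QuadraticConjugation.
Variables (F : fieldType) (E : fieldExtType F) (alpha : E).
Hypotheses (dimE : \dim {:E} = 2%N) (alpha_notin : alpha \notin 1%VS).
Hypothesis alpha_sq : exists2 d : F, d != 0 & alpha ^+ 2 = d%:A.
Hypothesis two0 : 2%:R != 0 :> E.

Lemma quad_coord x : exists ab : F * F, x = ab.1%:A + alpha * ab.2%:A.
Proof.
have alpha0 : alpha != 0 by apply: contraNneq alpha_notin => ->; rewrite mem0v.
have cap0 : (1 :&: <[alpha]> = 0)%VS.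
  apply/eqP; rewrite -subv0; apply/subvP => y; rewrite memv_cap => /andP[y1 /vlineP[b yE]].
  rewrite memv0; apply: contraNT alpha_notin => y0.
  have b0 : b != 0 by apply: contraNneq y0 => b0; rewrite yE b0 scale0r.
  by rewrite -(scalerK b0 alpha) -yE memvZ.
have sumE : (1 + <[alpha]> = {:E})%VS.
  apply/eqP; rewrite eqEdim subvf /= dimE dimv_disjoint_sum // dimv1.
  by rewrite dim_vline alpha0.
have : x \in (1 + <[alpha]>)%VS by rewrite sumE memvf.
move=> /memv_addP[_ /vlineP[a ->] [_ /vlineP[b ->] ->]]; exists (a, b).
by rewrite /= -scalerAr mulr1.
Qed.

Lemma quad_coord_inj (a b a' b' : F) :
  a%:A + alpha * b%:A = a'%:A + alpha * b'%:A -> a = a' /\ b = b'.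
Proof.
move=> eqx; have [bb|bb] := eqVneq b b'.
  by move: eqx; rewrite bb => /addIr /(fmorph_inj (in_alg E)).
case/negP: alpha_notin; apply/vlineP; exists ((a' - a) / (b - b')).
have bb0 : in_alg E (b - b') != 0 by rewrite fmorph_eq0 subr_eq0.
change (alpha = in_alg E ((a' - a) / (b - b'))); rewrite fmorph_div.
apply: (mulIf bb0); rewrite divfK // !rmorphB /=.
by rewrite mulrBr -[alpha * b%:A](addKr a%:A) eqx; ring.
Qed.

Lemma quad_conjugation : exists s : {rmorphism E -> E},
  [/\ involutive s, s alpha = - alpha, forall a : F, s a%:A = a%:A
    & forall x, s x = x -> exists a : F, x = a%:A].
Proof.
have /choice[co coP] := quad_coord.
pose s x := (co x).1%:A - alpha * (co x).2%:A.
have sE a b : s (a%:A + alpha * b%:A) = a%:A - alpha * b%:A.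
  by rewrite /s; have [<- <-] := quad_coord_inj (coP (a%:A + alpha * b%:A)).
have inA (a b : F) : (a + b)%:A = a%:A + b%:A :> E by apply: (rmorphD (in_alg E)).
have inM (a b : F) : (a * b)%:A = a%:A * b%:A :> E by apply: (rmorphM (in_alg E)).
have inN (a : F) : (- a)%:A = - a%:A :> E by apply: (rmorphN (in_alg E)).
have sB : zmod_morphism s.
  move=> x y; rewrite (coP x) (coP y); move: (co x) (co y) => [a b] [a' b'] /=.
  have -> : a%:A + alpha * b%:A - (a'%:A + alpha * b'%:A) =
     (a - a')%:A + alpha * (b - b')%:A by rewrite !inA !inN; ring.
  by rewrite !sE !inA !inN; ring.
have sM : monoid_morphism s.
  split.
    have {1}-> : 1 = 1%:A + alpha * 0%:A :> E by rewrite scale0r mulr0 addr0 scale1r.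
    by rewrite sE scale0r mulr0 subr0 scale1r.
  move=> x y; rewrite (coP x) (coP y); move: (co x) (co y) => [a b] [a' b'] /=.
  have [d _ dE] := alpha_sq.
  have -> : (a%:A + alpha * b%:A) * (a'%:A + alpha * b'%:A) =
     (a * a' + d * (b * b'))%:A + alpha * (a * b' + b * a')%:A.
    by rewrite !(inA, inM) -dE; ring.
  by rewrite !sE !(inA, inM) -dE; ring.
pose sA := GRing.isZmodMorphism.Build E E s sB.
pose sR := GRing.isMonoidMorphism.Build E E s sM.
pose S : {rmorphism E -> E} := HB.pack s sA sR.
exists S; split=> [x||a|x] /=.
- by rewrite (coP x) sE -mulrN -inN sE inN mulrN opprK.
- have {1}-> : alpha = 0%:A + alpha * 1%:A by rewrite scale0r add0r scale1r mulr1.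
  by rewrite sE scale0r scale1r mulr1 sub0r.
- have {1}-> : a%:A = a%:A + alpha * 0%:A :> E by rewrite scale0r mulr0 addr0.
  by rewrite sE scale0r mulr0 subr0.
rewrite {2}(coP x) {1}/s => sx; exists (co x).1; rewrite {1}(coP x).
have /eqP : 2%:R * (alpha * (co x).2%:A) = 0.
  rewrite -[RHS](subrr ((co x).1%:A + alpha * (co x).2%:A)) -{2}sx; ring.
by rewrite mulf_eq0 (negPf two0) /= => /eqP ->; rewrite addr0.
Qed.

End QuadraticConjugation.

(** * Compactness in finite extensions *)

Section ExtensionCompactness.
Variables (R : realType) (p : nat) (Qp : fieldType) (absQp : Qp -> R).
Hypotheses (p_prime : prime p) (QpP : padic_field p absQp).
Variables (F : fieldExtType Qp) (E : fieldExtType F) (v : E -> R).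
Hypotheses (vP : nonarch_abs v).
Hypothesis v_ext : forall c : Qp, v ((c%:A : F)%:A) = absQp c.
Variables (U : set_system nat).
Context {UU : UltraFilter U}.
Hypothesis U_oo : \oo `<=` U.

Let base : set E := [set (c%:A : F)%:A | c in @setT Qp].

Lemma base_mul (c : Qp) (x : F) : (c%:A : F)%:A * x%:A = (c *: x)%:A :> E.
Proof. by rewrite mulr_algl scalerA mulr_algl. Qed.

Lemma base_ucompact : ucompact v U base.
Proof.
move=> f fb [C fC].
have /choice[c cP] : forall n, exists c : Qp, f n = (c%:A : F)%:A.
  by move=> n; have [c _ <-] := fb n; exists c.
have [//||l _ cl] := padic_ucompact p_prime QpP UU U_oo (f := c).
  by exists C; apply: filterS fC => n; rewrite cP v_ext.
exists (l%:A : F)%:A; first by exists l.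
move=> e /cl; apply: filterS => n; rewrite -v_ext; congr (v _ < _).
by rewrite cP !scalerBl.
Qed.

(** Induction on the dimension, adjoining one vector at a time; the sets live in
    [E] because the absolute value is given there. *)
Lemma span_ucompact (X : seq F) :
  ucompact v U [set a%:A | a in [set a | a \in <<X>>%VS]].
Proof.
elim: X => [|x X IH].
  move=> f f0 _; exists 0; first by exists 0; rewrite ?scale0r //= mem0v.
  have -> : f = fun=> 0.
    apply: funext => n; have [a /=] := f0 n.
    by rewrite span_nil memv0 => /eqP -> <-; rewrite scale0r.
  exact: tends_cst.
have [xX|xX] := boolP (x \in <<X>>%VS).
  suff -> : <<x :: X>>%VS = <<X>>%VS by [].
  by rewrite span_cons; apply/addv_idPr; rewrite -memvE.
have -> : [set a%:A | a in [set a | a \in <<x :: X>>%VS]] =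
  [set z : E | exists2 y, [set a%:A | a in [set a | a \in <<X>>%VS]] y &
    exists2 c, base c & z = y + c * x%:A].
  apply/seteqP; split=> z.
    move=> [a /=]; rewrite span_cons => /memv_addP[_ /vlineP[c ->] [b bX ->]] <-.
    exists b%:A; first by exists b.
    exists (c%:A : F)%:A; first by exists c.
    by rewrite base_mul scalerDl addrC.
  move=> [_ [b bX <-] [_ [c _ <-] ->]]; exists (c *: x + b).
    by rewrite /= span_cons memv_add // memvZ // memv_line.
  by rewrite base_mul scalerDl addrC.
apply: (ucompact_add vP U_oo) => //.
- by exists (-1) => //; rewrite !scaleN1r.
- move=> _ [c _ <-]; exists c^-1 => //.
  by change (in_alg E (in_alg F c^-1) = (in_alg E (in_alg F c))^-1); rewrite !fmorphV.
- move=> _ _ [c _ <-] [b bX <-]; exists (c *: b); first by rewrite /= memvZ.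
  by rewrite base_mul.
- exact: base_ucompact.
- by move=> [a aX /(fmorph_inj (in_alg E)) ax]; move: xX; rewrite -ax aX.
Qed.

Lemma subfield_ucompact : ucompact v U [set a%:A | a in @setT F].
Proof.
have -> : @setT F = [set a | a \in <<vbasis {:F}>>%VS].
  by apply/seteqP; split=> // a _ /=; rewrite (span_basis (vbasisP _)) memvf.
exact: span_ucompact.
Qed.

End ExtensionCompactness.

Section QuadraticCompactness.
Variables (R : realType) (F : fieldType) (E : fieldExtType F) (v : E -> R).
Hypothesis vP : nonarch_abs v.
Variables (U : set_system nat).
Context {UU : UltraFilter U}.
Hypothesis U_oo : \oo `<=` U.
Let k : set E := [set a%:A | a in @setT F].
Hypothesis F_ucompact : ucompact v U k.
Variable alpha : E.
Hypotheses (dimE : \dim {:E} = 2%N) (alpha_notin : alpha \notin 1%VS).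

Let kN1 : k (-1). Proof. by exists (-1); rewrite ?scaleN1r. Qed.

Let kV c : k c -> k c^-1.
Proof. by move=> [a _ <-]; exists a^-1; rewrite // -[_%:A]/(in_alg E _) fmorphV. Qed.

Let kM c d : k c -> k d -> k (c * d).
Proof. by move=> [a _ <-] [b _ <-]; exists (a * b); rewrite // mulr_algl scalerA. Qed.

Let k_alpha : ~ k alpha.
Proof. by move=> [a _ aE]; case/negP: alpha_notin; apply/vlineP; exists a. Qed.

Lemma quad_ucompact : ucompact v U setT.
Proof.
have E_sum : forall x : E, exists2 y, k y & exists2 c, k c & x = y + c * alpha.
  move=> x; have [[a b] /= ->] := quad_coord dimE alpha_notin x.
  by exists a%:A; [exists a | exists b%:A; [exists b | rewrite mulrC]].
move=> f _ fb; have add := ucompact_add vP U_oo kN1 kV kM F_ucompact F_ucompact k_alpha.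
by have [l _ fl] := add _ f (fun n => E_sum _) fb; exists l.
Qed.

(** In place of the invariance of the absolute value under conjugation, a bound
    suffices for continuity; it comes from the bound on the coefficient of
    [alpha]. *)
Lemma quad_conj_lipschitz (s : {rmorphism E -> E}) :
  s alpha = - alpha -> (forall a : F, s a%:A = a%:A) ->
  exists C, forall x, v (s x) <= C * v x.
Proof.
move=> sa sF; have [d d0 dP] := ucompact_coeff vP U_oo kN1 kV kM F_ucompact k_alpha.
exists (Num.max 1 (v (2%:R * alpha) / d)) => x.
have [[a b] /= xE] := quad_coord dimE alpha_notin x.
have vb : v b%:A * d <= v x.
  by rewrite xE [alpha * _]mulrC; apply: dP; [exists a | exists b].
have -> : s x = x - 2%:R * alpha * b%:A.
  by rewrite xE rmorphD rmorphM /= sa !sF; ring.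
apply: (absB_le vP).
  by rewrite ler_peMl ?(abs_ge0 vP) // le_max lexx.
apply: (@le_trans _ _ (v (2%:R * alpha) / d * v x)).
  rewrite (absM vP) -mulrA ler_wpM2l ?(abs_ge0 vP) //.
  by rewrite ler_pdivlMl // mulrC.
by rewrite ler_wpM2r ?(abs_ge0 vP) // le_max lexx orbT.
Qed.

End QuadraticCompactness.

(** * Two by two matrices and conjugate subgroups *)

Section Matrices2.
Variable K : fieldType.
Implicit Types (a b c d : K).

Lemma ord2E (i : 'I_2) : i = if i == 0 then 0 else 1.
Proof. by case: i => [[|[|//]] ?]; apply: val_inj. Qed.

Lemma mx2E (A : 'M[K]_2) : A = mx2 (A 0 0) (A 0 1) (A 1 0) (A 1 1).
Proof. by apply/matrixP => i j; rewrite mxE; rewrite {1}(ord2E i) {1}(ord2E j); do 2!case: ifP. Qed.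

Lemma mul_mx2 a b c d a' b' c' d' :
  mx2 a b c d *m mx2 a' b' c' d' =
  mx2 (a * a' + b * c') (a * b' + b * d') (c * a' + d * c') (c * b' + d * d').
Proof.
apply/matrixP => i j; rewrite !mxE big_ord_recl big_ord1 !mxE.
by do 2!case: ifP.
Qed.

Lemma det_mx2 a b c d : \det (mx2 a b c d) = a * d - b * c.
Proof. rewrite (expand_det_row _ ord0) !big_ord_recl big_ord0 /cofactor !det_mx11 !mxE /=.
by rewrite expr0 expr1; ring. Qed.

Lemma mx2_inj a b c d a' b' c' d' :
  mx2 a b c d = mx2 a' b' c' d' -> [/\ a = a', b = b', c = c' & d = d'].
Proof.
move=> /matrixP eqA.
by split; [have := eqA 0 0|have := eqA 0 1|have := eqA 1 0|have := eqA 1 1]; rewrite !mxE.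
Qed.

Lemma tr_mx2 a b c d : (mx2 a b c d)^T = mx2 a c b d.
Proof. by rewrite [LHS]mx2E !mxE. Qed.

Lemma map_mx2 (f : K -> K) a b c d : map_mx f (mx2 a b c d) = mx2 (f a) (f b) (f c) (f d).
Proof. by rewrite [LHS]mx2E !mxE. Qed.

Lemma mx2_1 : 1%:M = mx2 1 0 0 1 :> 'M[K]_2.
Proof. by rewrite [LHS]mx2E !mxE. Qed.

Lemma SL_unit n (A : 'M[K]_n) : \det A = 1 -> A \in unitmx.
Proof. by move=> A1; rewrite unitmxE A1 unitr1. Qed.

Lemma inv_mx2 a b c d : a * d - b * c = 1 -> invmx (mx2 a b c d) = mx2 d (- b) (- c) a.
Proof.
move=> D1; have U1 : mx2 a b c d \in unitmx by apply: SL_unit; rewrite det_mx2.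
rewrite -[RHS](mulKmx U1) mul_mx2.
have -> : a * d + b * - c = 1 by rewrite -D1; ring.
have -> : a * - b + b * a = 0 by ring.
have -> : c * d + d * - c = 0 by ring.
have -> : c * - b + d * a = 1 by rewrite -D1; ring.
by rewrite -mx2_1 mulmx1.
Qed.

Lemma invmxM n (A B : 'M[K]_n) : A \in unitmx -> B \in unitmx ->
  invmx (A *m B) = invmx B *m invmx A.
Proof.
move=> AU BU; have ABU : A *m B \in unitmx by rewrite unitmx_mul AU.
by apply: (can_inj (mulKmx ABU)); rewrite mulmxV // mulmxA mulmxK // mulmxV.
Qed.

Lemma conj_setM n (g h : 'M[K]_n) (H : set 'M[K]_n) : g \in unitmx -> h \in unitmx ->
  conj_set g (conj_set h H) = conj_set (g *m h) H.
Proof.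
move=> gU hU; have inv := invmxM gU hU.
apply/seteqP; split=> A.
  by move=> [_ [B HB <-] <-]; exists B; rewrite // inv !mulmxA.
by move=> [B HB <-]; exists (h *m B *m invmx h); [exists B | rewrite inv !mulmxA].
Qed.

Lemma conj_setE n (k : 'M[K]_n) (S : set 'M[K]_n) A : k \in unitmx ->
  conj_set k S A <-> S (invmx k *m A *m k).
Proof.
move=> kU; split=> [[B SB <-]|SA]; first by rewrite !mulmxA mulVmx // mul1mx mulmxKV.
by exists (invmx k *m A *m k); rewrite // !mulmxA mulmxV // mul1mx mulmxK.
Qed.

Lemma SLM n (A B : 'M[K]_n) : SL n K A -> SL n K B -> SL n K (A *m B).
Proof. by rewrite /SL /= => A1 B1; rewrite det_mulmx A1 B1 mulr1. Qed.

End Matrices2.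

(** * Chabauty limits along an ultrafilter *)

Section MatrixLimits.
Variables (R : realType) (K : fieldType) (v : K -> R).
Hypothesis vP : nonarch_abs v.
Variables (U : set_system nat).
Context {UF : ProperFilter U}.
Variable n : nat.

Definition mx_tends (u : nat -> 'M[K]_n) (A : 'M[K]_n) : Prop :=
  forall i j, tends v U (fun m => u m i j) (A i j).

Lemma tends_sum (I : Type) (s : seq I) (f : I -> nat -> K) (a : I -> K) :
  (forall i, tends v U (f i) (a i)) ->
  tends v U (fun m => \sum_(i <- s) f i m) (\sum_(i <- s) a i).
Proof.
move=> fa; elim: s => [|i s IH].
  rewrite big_nil; apply: (tends_near (f := fun=> 0)); last exact: tends_cst.
  by near=> m; rewrite big_nil.
rewrite big_cons; apply: (tends_near (f := fun m => f i m + \sum_(j <- s) f j m)).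
  by near=> m; rewrite big_cons.
exact: tendsD.
Unshelve. all: by end_near. Qed.

Lemma mx_tends_near u w A : (\forall m \near U, u m = w m) -> mx_tends u A -> mx_tends w A.
Proof.
by move=> uw uA i j; apply: tends_near (uA i j); apply: filterS uw => m ->.
Qed.

Lemma mx_tendsM u w A B : mx_tends u A -> mx_tends w B ->
  mx_tends (fun m => u m *m w m) (A *m B).
Proof.
move=> uA wB i j; rewrite mxE.
apply: (tends_near (f := fun m => \sum_k u m i k * w m k j)).
  by near=> m; rewrite mxE.
by apply: tends_sum => k; apply: tendsM.
Unshelve. all: by end_near. Qed.

Lemma mx_tends_cst A : mx_tends (fun=> A) A.
Proof. by move=> i j; apply: tends_cst. Qed.

End MatrixLimits.

Section UltraChabauty.
Variables (R : realType) (K : fieldType) (v : K -> R).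
Hypothesis vP : nonarch_abs v.
Variables (U : set_system nat).
Context {UF : ProperFilter U}.
Hypothesis U_oo : \oo `<=` U.
Variable n : nat.

Lemma tends_abs_cvg (f : nat -> K) a : abs_cvg v f a -> tends v U f a.
Proof.
move=> fa e e0; apply: U_oo; move/cvgrPdist_lt: fa => /(_ e e0); apply: filterS => m.
by rewrite sub0r normrN ger0_norm ?(abs_ge0 vP).
Qed.

(** The only place where an honest subsequence is needed: the second clause of
    Chabauty convergence speaks of subsequences, while the rest of the argument
    produces limits along [U]. *)
Lemma mx_tends_subseq (P : set nat) (u : nat -> 'M[K]_n) A : U P -> mx_tends v U u A ->
  exists k : nat -> nat, [/\ {homo k : i j / (i < j)%N}, forall m, P (k m) & mx_cvg v (u \o k) A].
Proof.
move=> UP uA.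
pose good j m := P m /\ forall i i', v (u m i i' - A i i') < j.+1%:R^-1.
have Ugood j : U (good j).
  apply: filterI => //; apply: filter_forall => i; apply: filter_forall => i'.
  by apply: uA; rewrite invr_gt0 ltr0Sn.
have /choice[nx nxP] : forall jN : nat * nat, exists m, (jN.2 < m)%N /\ good jN.1 m.
  move=> [j N]; have UN : U [set m | (N < m)%N] by apply: U_oo; exists N.+1.
  by have [m [Nm jm]] := filter_ex (filterI UN (Ugood j)); exists m.
pose k := fix k j := if j is j'.+1 then nx (j, k j') else nx (0%N, 0%N).
have kgood j : good j (k j)
  by case: j => [|j]; [apply: (nxP (0, 0)%N).2 | apply: (nxP (j.+1, k j)).2].
exists k; split=> [|m|i i'].
- by apply: homo_ltn => [? ? ?|j]; [apply: ltn_trans | have [] := nxP (j.+1, k j)].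
- by have [] := kgood m.
apply/cvgrPdist_lt => e e0; near=> m.
rewrite sub0r normrN ger0_norm ?(abs_ge0 vP) //.
apply: lt_trans ((kgood m).2 i i') _; near: m.
exact: (near_infty_natSinv_lt (PosNum e0)).
Unshelve. all: by end_near. Qed.

(** A Chabauty limit is determined by the limits along a single free
    ultrafilter. The identity matrix fills in the indices at which the
    condition [Hs m (u m)] fails. *)
Lemma chabauty_ultra (G : set 'M[K]_n) Hs L : L `<=` G -> chabauty_cvg v G Hs L ->
  (forall m, Hs m 1%:M) ->
  forall A, L A <-> G A /\ exists2 u, (\forall m \near U, Hs m (u m)) & mx_tends v U u A.
Proof.
move=> LG [Llim limL] Hs1 A; split=> [LA|[GA [u uH uA]]].
  split; first exact: LG.
  have [u uH uA] := Llim A LA; exists u; first exact: nearW.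
  by move=> i j; apply: tends_abs_cvg; apply: uA.
have [k [kS kH kA]] := mx_tends_subseq uH uA.
pose u' m := if pselect (Hs m (u m)) then u m else 1%:M.
apply: (limL u' k) => //.
  by move=> m; rewrite /u'; case: pselect.
suff -> : u' \o k = u \o k by [].
by apply: funext => m; rewrite /= /u'; case: pselect => // nH; case: nH; apply: kH.
Qed.

End UltraChabauty.

(** * Special unitary groups of binary hermitian forms *)

Section Unitary.
Variables (K : fieldType) (s : {rmorphism K -> K}) (alpha : K).
Hypotheses (s_inv : involutive s) (s_alpha : s alpha = - alpha).
Hypotheses (alpha0 : alpha != 0) (two0 : 2%:R != 0 :> K).

Definition adj (A : 'M[K]_2) : 'M[K]_2 := (map_mx s A)^T.

Lemma adj_mx2 a b c d : adj (mx2 a b c d) = mx2 (s a) (s c) (s b) (s d).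
Proof. by rewrite /adj map_mx2 tr_mx2. Qed.

Lemma adjM A B : adj (A *m B) = adj B *m adj A.
Proof. by rewrite /adj map_mxM trmx_mul. Qed.

Lemma adjK : involutive adj.
Proof. by move=> A; rewrite [A]mx2E !adj_mx2 !s_inv. Qed.

Lemma det_adj A : \det (adj A) = s (\det A).
Proof. by rewrite /adj det_tr det_map_mx. Qed.

Lemma adj1 : adj 1%:M = 1%:M.
Proof. by rewrite /adj map_mx1 trmx1. Qed.

Definition SU (h : 'M[K]_2) : set 'M[K]_2 := [set A | \det A = 1 /\ A *m h *m adj A = h].

Lemma SU_conj g h : \det g = 1 -> SU (g *m h *m adj g) = conj_set g (SU h).
Proof.
move=> g1; have gU := SL_unit g1.
have g'U : adj g \in unitmx by apply: SL_unit; rewrite det_adj g1 rmorph1.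
have gV1 : \det (invmx g) = 1 by rewrite det_inv g1 invr1.
have adjV : adj (invmx g) = invmx (adj g).
  by apply: (can_inj (mulmxK g'U)); rewrite -adjM mulmxV // adj1 mulVmx.
apply/seteqP; split=> A.
  move=> [A1 Ah]; exists (invmx g *m A *m g); last first.
    by rewrite !mulmxA mulmxV // mul1mx mulmxK.
  split; first by rewrite !det_mulmx A1 gV1 g1 !mulr1.
  rewrite !adjM adjV !mulmxA.
  have -> : invmx g *m A *m g *m h *m adj g *m adj A *m invmx (adj g) =
    invmx g *m (A *m (g *m h *m adj g) *m adj A) *m invmx (adj g) by rewrite !mulmxA.
  by rewrite Ah !mulmxA mulmxK // mulVmx // mul1mx.
move=> [B [B1 Bh] <-]; split; first by rewrite !det_mulmx B1 gV1 g1 !mulr1.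
rewrite !adjM adjV !mulmxA mulmxKV //.
have -> : g *m B *m h *m adj g *m invmx (adj g) *m adj B *m adj g = g *m (B *m h *m adj B) *m adj g.
  by rewrite mulmxK // !mulmxA.
by rewrite Bh.
Qed.

(** The group SL(2) over the field fixed by [s]. *)
Definition SLfix : set 'M[K]_2 := [set A | \det A = 1 /\ map_mx s A = A].

(** The standard symplectic matrix times [alpha]; as [s alpha = - alpha] it is
    hermitian, of determinant [alpha ^+ 2]. *)
Definition herm0 : 'M[K]_2 := mx2 0 alpha (- alpha) 0.

(** Every [A] of determinant 1 satisfies [A *m herm0 *m A^T = herm0]. Comparing
    with [A *m herm0 *m adj A = herm0] gives [adj A = A^T]. *)
Lemma SU_herm0 : SU herm0 = SLfix.
Proof.
have key A : \det A = 1 -> A *m herm0 *m A^T = herm0.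
  rewrite [A]mx2E det_mx2 => A1; rewrite /herm0 tr_mx2 !mul_mx2.
  set a := A 0 0 in A1 *; set b := A 0 1 in A1 *; set c := A 1 0 in A1 *; set d := A 1 1 in A1 *.
  congr mx2; try ring.
    by rewrite -[RHS]mulr1 -A1; ring.
  by rewrite -[RHS]mulr1 -A1; ring.
have h0U A : \det A = 1 -> A *m herm0 \in unitmx.
  rewrite unitmxE det_mulmx => ->; rewrite det_mx2 unitfE mul1r mul0r sub0r mulrN opprK.
  by rewrite mulf_neq0.
apply/seteqP; split=> A [A1 Ah]; split=> //.
  apply: trmx_inj; apply: (can_inj (mulKmx (h0U A A1))).
  by rewrite [RHS]key.
by rewrite /adj Ah key.
Qed.

(** The special unitary group of [diag (1 / r, alpha ^+ 2 * r)], rewritten so that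
    it still makes sense at [r = 0]. *)
Definition SUdiag (r : K) : set 'M[K]_2 :=
  [set A | exists a b, A = mx2 a b (- ((alpha * r) ^+ 2 * s b)) (s a) /\
                       a * s a + (alpha * r) ^+ 2 * (b * s b) = 1].

Lemma SU_diagE x : x != 0 -> s x = x ->
  SU (mx2 x 0 0 (alpha ^+ 2 / x)) = SUdiag x^-1.
Proof.
move=> x0 sx.
have s2 : s ((alpha / x) ^+ 2) = (alpha / x) ^+ 2.
  by rewrite rmorphXn fmorph_div s_alpha sx mulNr sqrrN.
apply/seteqP; split=> A.
  move=> [A1 Ah]; move: A1 Ah; rewrite [A]mx2E.
  move: (A 0 0) (A 0 1) (A 1 0) (A 1 1) => a b c d; rewrite det_mx2 adj_mx2 => A1 Ah.
  have sA1 : s a * s d - s c * s b = 1.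
    by rewrite -(rmorph1 s) -A1 rmorphB !rmorphM; ring.
  have adjU : mx2 (s a) (s c) (s b) (s d) \in unitmx by apply: SL_unit; rewrite det_mx2.
  have := congr1 (mulmx^~ (invmx (mx2 (s a) (s c) (s b) (s d)))) Ah.
  rewrite /= mulmxK // inv_mx2 // !mul_mx2 => /mx2_inj[_ _ e3 e4].
  have dE : d = s a.
    have a20 : alpha ^+ 2 / x != 0 by rewrite mulf_neq0 ?invr_eq0 ?expf_neq0.
    by apply: (mulIf a20); move: e4; rewrite !(mulr0, mul0r, add0r) mulrC => ->; rewrite mulrC.
  have cE : c = - ((alpha / x) ^+ 2 * s b).
    apply: (mulIf x0); move: e3; rewrite !(mulr0, mul0r, add0r, addr0) => ->.
    by field.
  exists a, b; rewrite -dE -cE; split=> //.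
  by rewrite -A1 cE; ring.
move=> [a [b [-> ab1]]]; split.
  by rewrite det_mx2 -ab1; ring.
rewrite adj_mx2 !mul_mx2 rmorphN rmorphM s2 !s_inv.
have e : alpha ^+ 2 / x = (alpha / x) ^+ 2 * x by field.
rewrite e; congr mx2; try ring.
  by rewrite -[RHS]mul1r -ab1; ring.
by rewrite -[RHS]mul1r -ab1; ring.
Qed.

(** Completing the square; as the determinant is [alpha ^+ 2], the form depends
    on [x] alone up to a unipotent congruence. *)
Lemma herm_diag x y b : x != 0 -> s x = x -> x * y - b * s b = alpha ^+ 2 ->
  mx2 x b (s b) y =
  mx2 1 0 (s b / x) 1 *m mx2 x 0 0 (alpha ^+ 2 / x) *m adj (mx2 1 0 (s b / x) 1).
Proof.
move=> x0 sx D; rewrite adj_mx2 !mul_mx2 rmorph0 rmorph1 fmorph_div s_inv sx -D.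
by congr mx2; field.
Qed.

(** A frame in which [herm0] becomes [diag (x, alpha ^+ 2 / x)]. Its first row is
    [(1, q)] with [s q = - q], where [q] makes [herm0] take the value [x] on that
    row; orthogonality and determinant 1 then force the second row. *)
Definition diag_frame x : 'M[K]_2 := mx2 1 (- (x / (2%:R * alpha))) (alpha / x) 2%:R^-1.

Lemma det_diag_frame x : x != 0 -> \det (diag_frame x) = 1.
Proof. by move=> x0; rewrite det_mx2; field; rewrite x0 alpha0 two0. Qed.

Lemma diag_frameE x : x != 0 -> s x = x ->
  mx2 x 0 0 (alpha ^+ 2 / x) = diag_frame x *m herm0 *m adj (diag_frame x).
Proof.
move=> x0 sx; rewrite adj_mx2 !mul_mx2 rmorphN !fmorph_div rmorphM !fmorphV s_alpha sx.
rewrite rmorph1 !rmorph_nat.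
by congr mx2; field; rewrite ?oppr_eq0 ?x0 ?alpha0 ?two0.
Qed.

Lemma SUdiag_conj x : x != 0 -> s x = x -> SUdiag x^-1 = conj_set (diag_frame x) SLfix.
Proof.
by move=> x0 sx; rewrite -SU_diagE // diag_frameE // SU_conj ?det_diag_frame // SU_herm0.
Qed.

End Unitary.

(** * Degeneration of the unitary groups *)

Lemma seq_max (R : realType) (T : eqType) (t : T) (l : seq T) (f : T -> R) :
  exists2 m, m \in t :: l & forall t', t' \in t :: l -> f t' <= f m.
Proof.
elim: l t => [|t' l IH] t; first by exists t; rewrite ?mem_head // => t'; rewrite inE => /eqP->.
have [m ml mP] := IH t'.
have [tm|mt] := leP (f t) (f m).
  exists m; first by rewrite inE ml orbT.
  by move=> x; rewrite inE => /predU1P[->//|/mP].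
exists t; first exact: mem_head.
move=> x; rewrite inE => /predU1P[->//|/mP fx]; exact: le_trans fx (ltW mt).
Qed.

Section UnitaryLimits.
Variables (R : realType) (K : fieldType) (v : K -> R).
Hypothesis vP : nonarch_abs v.
Variables (U : set_system nat).
Context {UU : UltraFilter U}.
Variables (s : {rmorphism K -> K}) (alpha : K).
Hypotheses (s_inv : involutive s) (s_alpha : s alpha = - alpha).
Hypotheses (alpha0 : alpha != 0) (two0 : 2%:R != 0 :> K).
Hypothesis s_lip : exists C, forall x, v (s x) <= C * v x.

Local Notation tends := (tends v U).
Local Notation mx_tends := (mx_tends v U).
Local Notation ubounded := (ubounded v U).
Local Notation SUdiag := (SUdiag s alpha).
Local Notation adj := (adj s).

Lemma tends_conj f a : tends f a -> tends (fun n => s (f n)) (s a).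
Proof.
move=> fa; have [C sC] := s_lip.
have C0 : 0 < C.
  have := sC 1; rewrite rmorph1 (abs1 vP) mulr1; exact: lt_le_trans ltr01.
move=> e e0; have := fa (e / C) (divr_gt0 e0 C0); apply: filterS => n.
rewrite -rmorphB ltr_pdivlMr // mulrC; exact: le_lt_trans.
Qed.

Lemma mx_tends2 (a b c d : nat -> K) a' b' c' d' :
  tends a a' -> tends b b' -> tends c c' -> tends d d' ->
  mx_tends (fun n => mx2 (a n) (b n) (c n) (d n)) (mx2 a' b' c' d').
Proof.
move=> aa bb cc dd i j; rewrite [X in tends X](_ : _ = fun n =>
  if i == 0 then if j == 0 then a n else b n else if j == 0 then c n else d n).
  by rewrite mxE; do 2!case: ifP.
by apply: funext => n; rewrite mxE.
Qed.

Lemma SUdiag_closed (r : nat -> K) r0 (A : nat -> 'M[K]_2) A0 : tends r r0 ->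
  (\forall n \near U, SUdiag (r n) (A n)) -> mx_tends A A0 -> SUdiag r0 A0.
Proof.
move=> rr AT AA; exists (A0 0 0), (A0 0 1).
have ra2 : tends (fun n => (alpha * r n) ^+ 2) ((alpha * r0) ^+ 2).
  by apply: (tendsM vP); apply: (tendsM vP) => //; apply: tends_cst.
have sa := tends_conj (AA 0 0); have sb := tends_conj (AA 0 1).
have nearE f g a b : tends f a -> tends g b -> (\forall n \near U, f n = g n) -> a = b.
  by move=> fa gb fg; apply: (tends_unique vP _ gb); apply: tends_near fa.
split.
  rewrite {1}[A0]mx2E; congr mx2.
    apply: (nearE _ _ _ _ (AA 1 0) (tendsN vP (tendsM vP ra2 sb))).
    by apply: filterS AT => n [a [b [-> _]]]; rewrite !mxE.
  apply: (nearE _ _ _ _ (AA 1 1) sa).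
  by apply: filterS AT => n [a [b [-> _]]]; rewrite !mxE.
refine (nearE _ _ _ _ (tendsD vP (tendsM vP (AA 0 0) sa)
  (tendsM vP ra2 (tendsM vP (AA 0 1) sb))) (tends_cst vP 1) _).
by apply: filterS AT => n [a [b [-> abE]]]; rewrite !mxE.
Qed.

(** The groups [SUdiag (r n)] fill [SUdiag r0] in the limit. For [r0 <> 0] it is
    enough to rescale the second entry. For [r0 = 0], an element is a point
    [(a0, b0)] with [a0 * s a0 = 1], and a nearby point on the quadric
    [a * s a + (alpha * r) ^+ 2 * (b * s b) = 1] is found by stereographic
    projection, which avoids extracting square roots. *)
Lemma SUdiag_approx (r : nat -> K) r0 A0 : tends r r0 ->
  (forall n, s (r n) = r n) -> (\forall n \near U, r n != 0) -> SUdiag r0 A0 ->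
  exists2 A, (\forall n \near U, SUdiag (r n) (A n)) & mx_tends A A0.
Proof.
move=> rr sr rn0 [a0 [b0 [-> ab1]]].
suff [a [b [aa bb abE]]] : exists a b, [/\ tends a a0, tends b b0 & \forall n \near U,
    a n * s (a n) + (alpha * r n) ^+ 2 * (b n * s (b n)) = 1].
  exists (fun n => mx2 (a n) (b n) (- ((alpha * r n) ^+ 2 * s (b n))) (s (a n))).
    by apply: filterS abE => n abn; exists (a n), (b n).
  apply: mx_tends2 => //; last exact: tends_conj.
  apply: (tendsN vP); apply: (tendsM vP); last exact: tends_conj.
  by apply: (tendsM vP); apply: (tendsM vP) => //; apply: tends_cst.
have [r00|r00] := eqVneq r0 0; last first.
  have sr0 : s r0 = r0.
    apply: (tends_unique vP _ rr).
    by apply: tends_near (tends_conj rr); apply: nearW.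
  exists (fun=> a0), (fun n => b0 * (r0 / r n)); split; first exact: tends_cst.
    rewrite [X in tends _ X](_ : _ = b0 * (r0 / r0)); last by rewrite divff ?mulr1.
    apply: (tendsM vP); first exact: tends_cst.
    by apply: (tendsM vP); [apply: tends_cst | apply: (tendsV vP)].
  apply: filterS rn0 => n rn; rewrite -ab1 rmorphM fmorph_div sr sr0.
  by field.
move: ab1; rewrite r00 mulr0 expr0n mul0r addr0 => aa1.
(* With q = (alpha r)^2 N(b0) / 4, the identity (1 - q)^2 + 4 q = (1 + q)^2
   puts (a0 (1 - q) / (1 + q), b0 / (1 + q)) on the quadric. *)
pose q n := (alpha * r n) ^+ 2 * (b0 * s b0) / 4%:R.
have q0 : tends q 0.
  have -> : 0 = (alpha * 0) ^+ 2 * (b0 * s b0) / 4%:R by rewrite mulr0 expr0n !mul0r.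
  rewrite -r00 /q; do 2!(apply: (tendsM vP); last exact: tends_cst).
  by apply: (tendsM vP); apply: (tendsM vP) => //; apply: tends_cst.
have sq n : s (q n) = q n.
  rewrite /q fmorph_div rmorph_nat rmorphM rmorphXn !rmorphM s_inv s_alpha sr.
  by rewrite mulNr sqrrN [s b0 * _]mulrC.
have four0 : 4%:R != 0 :> K by rewrite (natrM _ 2 2) mulf_neq0.
have q1 : tends (fun n => 1 + q n) 1.
  by rewrite -[X in tends _ X]addr0; apply: (tendsD vP) => //; apply: tends_cst.
have q1V : tends (fun n => (1 + q n)^-1) 1.
  by rewrite -[X in tends _ X]invr1; apply: (tendsV vP); rewrite ?oner_eq0.
exists (fun n => a0 * ((1 - q n) / (1 + q n))), (fun n => b0 / (1 + q n)); split.
- rewrite [X in tends _ X](_ : _ = a0 * ((1 - 0) * 1)); last by rewrite subr0 !mulr1.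
  apply: (tendsM vP); first exact: tends_cst.
  exact: (tendsM vP (tendsB vP (tends_cst vP 1) q0) q1V).
- rewrite [X in tends _ X](_ : _ = b0 * 1); last by rewrite mulr1.
  exact: (tendsM vP (tends_cst vP b0) q1V).
apply: filterS (tends_neq0 vP (oner_neq0 K) q1) => n vq.
have qn : 1 + q n != 0.
  by apply/eqP => qE; move: vq; rewrite qE (abs0 vP) (abs1 vP) => /esym/eqP; rewrite oner_eq0.
rewrite rmorphM !fmorph_div rmorphB rmorphD rmorph1 sq.
have -> : a0 * ((1 - q n) / (1 + q n)) * (s a0 * ((1 - q n) / (1 + q n))) =
  (a0 * s a0) * ((1 - q n) / (1 + q n)) ^+ 2 by ring.
have -> : (alpha * r n) ^+ 2 * (b0 / (1 + q n) * (s b0 / (1 + q n))) =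
  (alpha * r n) ^+ 2 * (b0 * s b0) / (1 + q n) ^+ 2 by move: (q n) qn => t t0; field.
have -> : (alpha * r n) ^+ 2 * (b0 * s b0) = 4%:R * q n by rewrite /q; field.
by rewrite aa1; move: (q n) qn => t t0; field.
Qed.

(** The hermitian form with entries [x], [b], [y] read in the frame [w]. *)
Definition herm_orbit (w : 'M[K]_2) x b y : 'M[K]_2 := w *m mx2 x b (s b) y *m adj w.

(** The values of a hermitian form on the first rows of these four matrices
    determine all its entries, by polarization. *)
Let frames : seq 'M[K]_2 := [:: 1%:M; mx2 0 1 (-1) 0; mx2 1 1 0 1; mx2 1 alpha 0 1].

(** The frame for which the upper left entry is largest along the ultrafilter.
    All entries of the form are then bounded by that entry [q], and the fixed
    determinant [alpha ^+ 2] forces [q] itself to stay away from 0. So both a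
    convergent and a diverging sequence of forms become, after completing the
    square, data that stay bounded. *)
Lemma good_frame (x b y : nat -> K) :
  (forall n, x n * y n - b n * s (b n) = alpha ^+ 2) ->
  exists2 w, \det w = 1 & let h n := herm_orbit w (x n) (b n) (y n) in
    [/\ \forall n \near U, h n 0 0 != 0, ubounded (fun n => (h n 0 0)^-1)
      & ubounded (fun n => h n 0 1 / h n 0 0)].
Proof.
move=> D.
pose h w n := herm_orbit w (x n) (b n) (y n).
have hE p q r t n : h (mx2 p q r t) n =
  mx2 ((p * x n + q * s (b n)) * s p + (p * b n + q * y n) * s q)
      ((p * x n + q * s (b n)) * s r + (p * b n + q * y n) * s t)
      ((r * x n + t * s (b n)) * s p + (r * b n + t * y n) * s q)
      ((r * x n + t * s (b n)) * s r + (r * b n + t * y n) * s t).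
  by rewrite /h /herm_orbit adj_mx2 !mul_mx2.
have [w wF wmax] : exists2 w, w \in frames & \forall n \near U,
    forall w', w' \in frames -> v (h w' n 0 0) <= v (h w n 0 0).
  apply: (ultra_exists_seq (P := fun w n =>
    forall w', w' \in frames -> v (h w' n 0 0) <= v (h w n 0 0))).
  apply: nearW => n; exact: (seq_max _ _ (fun w => v (h w n 0 0))).
have w1 : \det w = 1.
  move: wF; rewrite !inE => /or4P[] /eqP->; rewrite ?det1 ?det_mx2 //; ring.
exists w => //=; rewrite -/(h w).
pose q n : K := h w n 0 0.
have fr_le w' : w' \in frames -> ubounded (fun n => h w' n 0 0 / q n).
  move=> wF'; exists 1; apply: filterS wmax => n /(_ _ wF') le_q.
  rewrite (absM vP) (absV vP); have [->|q0] := eqVneq (v (q n)) 0.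
    by rewrite invr0 mulr0.
  by rewrite ler_pdivrMr ?mul1r // lt_def q0 (abs_ge0 vP).
have h1E n : h 1%:M n 0 0 = x n.
  by rewrite mx2_1 hE mxE /= rmorph1 rmorph0; ring.
have hJE n : h (mx2 0 1 (-1) 0) n 0 0 = y n.
  by rewrite hE mxE /= rmorph1 rmorph0; ring.
have h3E n : h (mx2 1 1 0 1) n 0 0 = x n + b n + s (b n) + y n.
  by rewrite hE mxE /= rmorph1; ring.
have h4E n : h (mx2 1 alpha 0 1) n 0 0 = x n + alpha * (s (b n) - b n) - alpha ^+ 2 * y n.
  by rewrite hE mxE /= rmorph1 s_alpha; ring.
(* Polarization: b from the values of the form at the four frames. *)
have bE n : b n = ((h (mx2 1 1 0 1) n 0 0 - h 1%:M n 0 0 - h (mx2 0 1 (-1) 0) n 0 0) -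
   alpha^-1 * (h (mx2 1 alpha 0 1) n 0 0 - h 1%:M n 0 0 +
       alpha ^+ 2 * h (mx2 0 1 (-1) 0) n 0 0)) * 2%:R^-1.
  by rewrite h1E hJE h3E h4E; field; rewrite alpha0 two0.
have sbE n : s (b n) = h (mx2 1 1 0 1) n 0 0 - h 1%:M n 0 0 - h (mx2 0 1 (-1) 0) n 0 0 - b n.
  by rewrite h1E hJE h3E; ring.
have F1 : 1%:M \in frames by rewrite !inE eqxx.
have F2 : mx2 0 1 (-1) 0 \in frames by rewrite !inE eqxx ?orbT.
have F3 : mx2 1 1 0 1 \in frames by rewrite !inE eqxx ?orbT.
have F4 : mx2 1 alpha 0 1 \in frames by rewrite !inE eqxx ?orbT.
have xb : ubounded (fun n => x n / q n).
  by have := fr_le _ F1; congr ubounded; apply: funext => n; rewrite h1E.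
have yb : ubounded (fun n => y n / q n).
  by have := fr_le _ F2; congr ubounded; apply: funext => n; rewrite hJE.
have cst c : ubounded (fun=> c) by exact: ubounded_cst.
have bb : ubounded (fun n => b n / q n).
  rewrite [X in ubounded X](_ : _ = fun n =>
    ((h (mx2 1 1 0 1) n 0 0 / q n - h 1%:M n 0 0 / q n - h (mx2 0 1 (-1) 0) n 0 0 / q n) -
    alpha^-1 * (h (mx2 1 alpha 0 1) n 0 0 / q n - h 1%:M n 0 0 / q n +
       alpha ^+ 2 * (h (mx2 0 1 (-1) 0) n 0 0 / q n))) * 2%:R^-1); last first.
    by apply: funext => n; rewrite {1}bE; ring.
  apply: (uboundedM vP) => //; apply: (uboundedB vP).
    by apply: (uboundedB vP); [apply: (uboundedB vP)|]; apply: fr_le.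
  apply: (uboundedM vP) => //; apply: (uboundedD vP).
    by apply: (uboundedB vP); apply: fr_le.
  by apply: (uboundedM vP) => //; apply: fr_le.
have sbb : ubounded (fun n => s (b n) / q n).
  rewrite [X in ubounded X](_ : _ = fun n => h (mx2 1 1 0 1) n 0 0 / q n -
      h 1%:M n 0 0 / q n - h (mx2 0 1 (-1) 0) n 0 0 / q n - b n / q n); last first.
    by apply: funext => n; rewrite {1}sbE !mulrBl.
  by do !apply: (uboundedB vP) => //; apply: fr_le.
split.
(* If q vanishes then so does the whole form, against its determinant. *)
- apply: filterS wmax => n wn; apply/negP => /eqP q0.
  have z w' : w' \in frames -> h w' n 0 0 = 0.
    move=> /wn; rewrite q0 (abs0 vP) => le0; apply/eqP; apply: contraTT le0 => nz.
    by rewrite -ltNge; apply: (abs_gt0 vP).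
  have bn : b n = 0 by rewrite bE !z // !(subr0, mulr0, addr0, mul0r).
  have := D n; rewrite -h1E z // bn !mul0r subr0 => /esym/eqP.
  by rewrite expf_eq0 (negPf alpha0) andbF.
(* (alpha / q)^2 is the determinant of the form divided by q. *)
- apply: (ubounded_sqrt vP).
  rewrite [X in ubounded X](_ : _ = fun n => alpha ^- 2 *
    ((x n / q n) * (y n / q n) - (b n / q n) * (s (b n) / q n))); last first.
    apply: funext => n.
    transitivity (alpha ^- 2 * ((x n * y n - b n * s (b n)) * (q n)^-1 * (q n)^-1)).
      2: by congr (_ * _); ring.
    by rewrite D -/(h w n) -/(q n); move: (q n)^-1 => t; field.
  apply: (uboundedM vP) => //; apply: (uboundedB vP); exact: (uboundedM vP).
have hw01 n : h w n 0 1 = (w 0 0 * x n + w 0 1 * s (b n)) * s (w 1 0) +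
    (w 0 0 * b n + w 0 1 * y n) * s (w 1 1) by rewrite {1}[w]mx2E hE mxE.
rewrite [X in ubounded X](_ : _ = fun n =>
   (w 0 0 * (x n / q n) + w 0 1 * (s (b n) / q n)) * s (w 1 0) +
   (w 0 0 * (b n / q n) + w 0 1 * (y n / q n)) * s (w 1 1)); last first.
  by apply: funext => n; rewrite -/(h w n) -/(q n) hw01; ring.
by apply: (uboundedD vP); apply: (uboundedM vP) => //; apply: (uboundedD vP); apply: (uboundedM vP).
Qed.

End UnitaryLimits.

(** * Limits of conjugates of the fixed group *)

Section UnitaryLimit.
Variables (R : realType) (K : fieldType) (v : K -> R).
Hypothesis vP : nonarch_abs v.
Variables (U : set_system nat).
Context {UU : UltraFilter U}.
Variables (s : {rmorphism K -> K}) (alpha : K).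
Hypotheses (s_inv : involutive s) (s_alpha : s alpha = - alpha).
Hypotheses (alpha0 : alpha != 0) (two0 : 2%:R != 0 :> K).
Hypothesis s_lip : exists C, forall x, v (s x) <= C * v x.
Hypothesis K_ucompact : ucompact v U setT.

Local Notation tends := (tends v U).
Local Notation mx_tends := (mx_tends v U).

Lemma adj_herm0 : adj s (herm0 alpha) = herm0 alpha.
Proof. by rewrite adj_mx2 rmorph0 rmorphN s_alpha opprK. Qed.

Lemma herm_entries (g : 'M[K]_2) : \det g = 1 ->
  let h := g *m herm0 alpha *m adj s g in
  [/\ h = mx2 (h 0 0) (h 0 1) (s (h 0 1)) (h 1 1), s (h 0 0) = h 0 0
    & h 0 0 * h 1 1 - h 0 1 * s (h 0 1) = alpha ^+ 2].
Proof.
move=> g1 h; have hh : adj s h = h by rewrite !adjM adj_herm0 adjK // mulmxA.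
have : \det h = alpha ^+ 2.
  rewrite !det_mulmx det_adj g1 rmorph1 det_mx2; ring.
move: hh; rewrite [h]mx2E; move: (h 0 0) (h 0 1) (h 1 0) (h 1 1) => x b c y.
by rewrite adj_mx2 det_mx2 !mxE /= => /mx2_inj[sx _ -> _] <-.
Qed.

Lemma det_SUdiag r A : SUdiag s alpha r A -> \det A = 1.
Proof. by move=> [a [b [-> ab1]]]; rewrite det_mx2 -ab1; ring. Qed.

(** The conjugates are [conj_set (k n) (SUdiag (r n))], with [k n] the product of
    a fixed frame and a unipotent matrix. Both [k n] and [r n] are bounded, so
    they converge along [U], and the limit group is read off. *)
Lemma unitary_limit (g : nat -> 'M[K]_2) (L : set 'M[K]_2) :
  (forall n, \det (g n) = 1) ->
  (forall A, L A <-> \det A = 1 /\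
     exists2 u, (\forall n \near U, conj_set (g n) (SLfix s) (u n)) & mx_tends u A) ->
  exists2 k, \det k = 1 & exists2 r, s r = r & L = conj_set k (SUdiag s alpha r).
Proof.
move=> g1 LP.
pose h n := g n *m herm0 alpha *m adj s (g n).
have hD n : h n 0 0 * h n 1 1 - h n 0 1 * s (h n 0 1) = alpha ^+ 2.
  by have [] := herm_entries (g1 n).
have [w w1] := good_frame vP s_alpha alpha0 two0 hD.
pose H n := (w *m g n) *m herm0 alpha *m adj s (w *m g n).
have wg1 n : \det (w *m g n) = 1 by rewrite det_mulmx w1 g1 mulr1.
have HE n : herm_orbit s w (h n 0 0) (h n 0 1) (h n 1 1) = H n.
  have [hE _ _] := herm_entries (g1 n).
  by rewrite /herm_orbit -hE /H adjM !mulmxA.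
have -> : (fun n => herm_orbit s w (h n 0 0) (h n 0 1) (h n 1 1)) = H.
  by apply: funext => n; exact: HE.
move=> [X0 rb cb].
have sX n : s (H n 0 0) = H n 0 0 by have [] := herm_entries (wg1 n).
have [r _ rr] := K_ucompact (fun=> I) rb.
have [c _ cc] := K_ucompact (fun=> I) cb.
have sr : s r = r.
  apply: (tends_unique vP _ rr); apply: tends_near (tends_conj vP s_lip rr).
  by apply: nearW => n; rewrite fmorphV sX.
pose u n := mx2 1 0 (s (H n 0 1) / H n 0 0) 1.
have wU := SL_unit w1.
have uU n : \det (u n) = 1 by rewrite det_mx2; ring.
pose k n := invmx w *m u n.
have kU n : k n \in unitmx by rewrite unitmx_mul unitmx_inv wU SL_unit.
have uc : mx_tends u (mx2 1 0 (s c) 1).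
  apply: mx_tends2; try exact: tends_cst.
  apply: tends_near (tends_conj vP s_lip cc).
  by apply: nearW => n; rewrite fmorph_div sX.
have uVc : mx_tends (fun n => invmx (u n)) (invmx (mx2 1 0 (s c) 1)).
  have inv t : invmx (mx2 1 0 t 1) = mx2 1 0 (- t) 1 :> 'M[K]_2.
    by rewrite inv_mx2 ?oppr0 //; ring.
  rewrite inv.
  apply: (mx_tends_near (u := fun n => mx2 1 0 (- (s (H n 0 1) / H n 0 0)) 1)).
    by apply: nearW => n; rewrite inv.
  apply: mx_tends2; try exact: tends_cst.
  apply: (tendsN vP); have := uc 1 0; rewrite mxE /=.
  by apply: tends_near; apply: nearW => n; rewrite mxE.
pose k0 := invmx w *m mx2 1 0 (s c) 1.
have u0U : mx2 1 0 (s c) 1 \in unitmx by apply: SL_unit; rewrite det_mx2; ring.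
have k01 : \det k0 = 1 by rewrite det_mulmx det_inv w1 invr1 det_mx2; ring.
have k0U := SL_unit k01.
have kk : mx_tends k k0 by apply: (mx_tendsM vP) => //; apply: mx_tends_cst.
have kVk : mx_tends (fun n => invmx (k n)) (invmx k0).
  rewrite invmxM ?unitmx_inv //.
  apply: (mx_tends_near (u := fun n => invmx (u n) *m invmx (invmx w))).
    by apply: nearW => n; rewrite invmxM ?unitmx_inv ?SL_unit.
  by apply: (mx_tendsM vP) => //; apply: mx_tends_cst.
have kE : \forall n \near U,
    conj_set (g n) (SLfix s) = conj_set (k n) (SUdiag s alpha (H n 0 0)^-1).
  apply: filterS X0 => n X0.
  have [HnE _ D] := herm_entries (wg1 n).
  have : SU s (H n) = conj_set (w *m g n) (SLfix s).
    by rewrite SU_conj // (SU_herm0 s alpha0).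
  have {}HnE : H n = mx2 (H n 0 0) (H n 0 1) (s (H n 0 1)) (H n 1 1) := HnE.
  rewrite {1}HnE (herm_diag s_inv X0 (sX n) D) -/(u n) SU_conj // SU_diagE //.
  move=> /(congr1 (conj_set (invmx w))); rewrite !conj_setM ?unitmx_inv ?unitmx_mul ?wU ?SL_unit //.
  by rewrite mulKmx.
clearbody k0; exists k0 => //; exists r => //.
apply/seteqP; split=> A.
  move=> /LP[A1 [t tE tA]]; apply/(conj_setE _ _ k0U).
  apply: (SUdiag_closed vP s_lip rr
    (A := fun n => invmx (k n) *m t n *m k n)).
    by apply: filterS (filterI tE kE) => n [+ knE]; rewrite knE => /(conj_setE _ _ (kU n)).
  by apply: (mx_tendsM vP) => //; apply: (mx_tendsM vP).
move=> [B SB <-]; apply/LP; split.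
  by rewrite !det_mulmx (det_SUdiag SB) det_inv k01 invr1 !mulr1.
have [||B_ BS BB] := SUdiag_approx vP s_inv s_alpha two0 s_lip rr _ _ SB.
- by move=> n; rewrite fmorphV sX.
- by apply: filterS X0 => n; rewrite invr_eq0.
exists (fun n => k n *m B_ n *m invmx (k n)).
  by apply: filterS (filterI BS kE) => n [Bn ->]; exists (B_ n).
by apply: (mx_tendsM vP) => //; apply: (mx_tendsM vP).
Qed.

End UnitaryLimit.

(** * The two limit groups over a quadratic extension *)

Section Descent.
Variables (F : fieldType) (E : fieldExtType F) (alpha : E) (s : {rmorphism E -> E}).
Hypotheses (sF : forall a : F, s a%:A = a%:A).
Hypothesis s_fix : forall x, s x = x -> exists a : F, x = a%:A.

Lemma SLfix_descent : SLfix s = SL_sub 2 E.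
Proof.
apply/seteqP; split=> A.
  move=> [A1 sA].
  have /choice[B BE] : forall ij : 'I_2 * 'I_2, exists a : F, A ij.1 ij.2 = a%:A.
    by move=> [i j]; apply: s_fix; have /matrixP/(_ i j) := sA; rewrite mxE.
  have AE : A = map_mx (in_alg E) (\matrix_(i, j) B (i, j)).
    by apply/matrixP => i j; rewrite !mxE; apply: (BE (i, j)).
  exists (\matrix_(i, j) B (i, j)); last by rewrite -AE.
  by apply: (fmorph_inj (in_alg E)); rewrite -det_map_mx -AE A1 rmorph1.
move=> [B B1 <-]; split; first by rewrite det_map_mx (B1 : \det B = 1) rmorph1.
by apply/matrixP => i j; rewrite !mxE; apply: sF.
Qed.

Lemma SUdiag0_borel : \dim {:E} = 2%N -> alpha \notin 1%VS -> s alpha = - alpha ->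
  SUdiag s alpha 0 = nonsplit_borel alpha.
Proof.
move=> dimE alphaF sa; apply/seteqP; split=> A.
  move=> [x [z [-> x1]]]; have [[a b] /= xE] := quad_coord dimE alphaF x.
  have bN : (- b)%:A = - b%:A :> E by rewrite scaleNr.
  have sx : s x = a%:A - alpha * b%:A by rewrite xE rmorphD rmorphM sa !sF mulNr.
  exists a, (- b), z; split.
    by rewrite -[RHS]x1 sx xE bN; ring.
  by rewrite sx xE bN; congr mx2; ring.
move=> [a [b [z [ab1 ->]]]]; exists (a%:A - alpha * b%:A), z.
have -> : s (a%:A - alpha * b%:A) = a%:A + alpha * b%:A.
  by rewrite rmorphB rmorphM sa !sF; ring.
split; first by congr mx2; ring.
by rewrite -[RHS]ab1; ring.
Qed.

End Descent.

Theorem theorem1p4 (R : realType) (p : nat) (p_prime : prime p) (p_neq2 : p <> 2%N)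
  (Qp : fieldType) (absQp : Qp -> R) (QpP : padic_field p absQp)
  (F : fieldExtType Qp) (E : fieldExtType F)
  (absE : E -> R) (absEP : nonarch_abs absE)
  (absE_ext : forall c : Qp, absE ((c%:A : F)%:A) = absQp c)
  (dimE : \dim {:E} = 2%N)
  (alpha : E) (E_gen : <<1; alpha>>%VS = {:E}%VS)
  (alpha_sq : exists2 d : F, d != 0 & alpha ^+ 2 = d%:A)
  (alpha_notin : alpha \notin 1%VS)
  (L : set 'M[E]_2)
  (L_lim : chabauty_limit absE (SL 2 E) (SL_sub 2 E) L) :
  conjugate_in (SL 2 E) L (SL_sub 2 E) \/
  conjugate_in (SL 2 E) L (nonsplit_borel alpha).
Proof.
have two0 : 2%:R != 0 :> E.
  have : in_alg E (in_alg F (2%:R : Qp)) != 0.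
    by rewrite !fmorph_eq0 (padic_char0 p_prime QpP).
  by rewrite !rmorph_nat.
have alpha0 : alpha != 0 by apply: contraNneq alpha_notin => ->; rewrite mem0v.
(* Fix a free ultrafilter; all limits below are along it. *)
have [U [UU U_oo]] := ultraFilterLemma eventually_filter.
have Fc : ucompact absE U [set a%:A | a in @setT F].
  exact: (subfield_ucompact p_prime QpP).
have Ec : ucompact absE U setT by apply: (quad_ucompact _ _ Fc dimE alpha_notin).
have [s [s_inv sa sF s_fix]] := quad_conjugation dimE alpha_notin alpha_sq two0.
have s_lip : exists C, forall x, absE (s x) <= C * absE x.
  exact: (quad_conj_lipschitz _ U_oo Fc dimE alpha_notin).
have SLE := SLfix_descent sF s_fix.
have [[LG _ _ _ _] [g gG lim]] := L_lim.
have H1 m : conj_set (g m) (SL_sub 2 E) 1%:M.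
  exists 1%:M; last by rewrite mulmx1 mulmxV // SL_unit // gG.
  by rewrite -SLE; split; rewrite ?det1 ?map_mx1.
have LP A : L A <-> SL 2 E A /\ exists2 u,
    (\forall m \near U, conj_set (g m) (SL_sub 2 E) (u m)) & mx_tends absE U u A.
  exact: (chabauty_ultra absEP U_oo LG lim H1 A).
rewrite -SLE in LP *.
have [k k1 [r sr ->]] := unitary_limit absEP s_inv sa alpha0 two0 s_lip Ec gG LP.
have [->|r0] := eqVneq r 0.
  by right; exists k => //; rewrite (SUdiag0_borel sF dimE alpha_notin sa).
(* For r != 0 the form diag (1 / r, alpha ^+ 2 * r) is congruent to herm0. *)
left; rewrite -[r]invrK SUdiag_conj ?invr_eq0 ?fmorphV ?sr //.
exists (k *m diag_frame alpha r^-1).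
  by apply: SLM => //; rewrite /SL /= det_diag_frame ?invr_eq0.
by rewrite conj_setM // ?SL_unit // det_diag_frame ?invr_eq0.
Qed.
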